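(* Let $\Delta=(\delta_0,\ldots,\delta_g)$ be a $\delta$-sequence. Put $n_i=n_i(\Delta)$ for $1\le i\le g$ and $a_i=\delta_i/\prod_{j=i+1}^g n_j$ for $1\le i\le g$. Then $\Delta$ can be computed by successive gluings with the trivial $\delta$-sequence $T=(1)$ as $$\Delta=\Big(\cdots\big((T\cup_{n_1,a_1}T)\cup_{n_2,a_2}T\big)\cdots\Big)\cup_{n_g,a_g}T .$$
   Context: $\mathbb{N}$ denotes the non-negative integers, and $\langle r_0,\ldots,r_m\rangle=\mathbb{N}r_0+\cdots+\mathbb{N}r_m$ is the semigroup generated by $r_0,\ldots,r_m$. For a finite sequence $\Lambda=(r_0,\ldots,r_m)$ of positive integers put $d_i(\Lambda)=\gcd(r_0,\ldots,r_{i-1})$ for $1\le i\le m+1$, $n_i(\Lambda)=d_i(\Lambda)/d_{i+1}(\Lambda)$ for $1\le i\le m$, and $n_0(\Lambda)=1$. A sequence $\Delta=(\delta_0,\ldots,\delta_g)$ of positive integers with $g>0$ is a $\delta$-sequence if, with $d_i=d_i(\Delta)$ and $n_i=n_i(\Delta)$: (a) $d_{g+1}=1$ and $n_i>1$ for $1\le i\le g$; (b) $n_i\delta_i\in\langle\delta_0,\ldots,\delta_{i-1}\rangle$ for $1\le i\le g$; (c) $\delta_i<n_{i-1}\delta_{i-1}$ for $1\le i\le g$. By convention the one-term sequence $T=(1)$ is also a $\delta$-sequence (with $g=0$). An empty product equals $1$. For a $\delta$-sequence $\Delta$ the numbers $a_i$ in the claim are positive integers, coprime to $n_i$. Gluing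 of $\delta$-sequences: let $\Delta_1=(\delta_0^{(1)},\ldots,\delta_{g_1}^{(1)})$ and $\Delta_2=(\delta_0^{(2)},\ldots,\delta_{g_2}^{(2)})$ be $\delta$-sequences generating semigroups $S_{\Delta_1}$, $S_{\Delta_2}$, and let $\alpha\in S_{\Delta_2}$, $\beta\in S_{\Delta_1}$ satisfy $\gcd(\alpha,\beta)=1$, $\alpha=m\,\delta_0^{(2)}$ with an integer $m>1$, and $\beta<m\cdot n_{g_1}(\Delta_1)\cdot\delta_{g_1}^{(1)}$. Then the sequence $\Delta_1\cup_{\alpha,\beta}\Delta_2:=(\alpha\delta_0^{(1)},\ldots,\alpha\delta_{g_1}^{(1)},\beta\delta_0^{(2)},\ldots,\beta\delta_{g_2}^{(2)})$ (which is again a $\delta$-sequence) is called the gluing of $\Delta_1$ and $\Delta_2$ through $\alpha$ and $\beta$. The claim includes that at each step the gluing is defined, i.e. that these conditions hold. *)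

(* Defs.v *)
From mathcomp Require Import all_boot.

Set Implicit Arguments.
Unset Strict Implicit.
Unset Printing Implicit Defensive.

(* A finite sequence (r_0, ..., r_m) is a [seq nat] of size m.+1, so r_i is
   [nth 0 s i] and m is [(size s).-1]. *)

Definition seq_d (s : seq nat) (i : nat) : nat :=
  \big[gcdn/0]_(r <- take i s) r.

Definition seq_n (s : seq nat) (i : nat) : nat :=
  if i == 0 then 1 else seq_d s i %/ seq_d s i.+1.

Definition in_semigroup (s : seq nat) (x : nat) : Prop :=
  exists c : nat -> nat, x = \sum_(j < size s) c j * nth 0 s j.

Definition trivial_seq : seq nat := [:: 1].

Definition delta_sequence (s : seq nat) : Prop :=
  s = trivial_seq \/
  let g := (size s).-1 in
  [/\ 0 < g,
      forall r, r \in s -> 0 < r,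
      seq_d s g.+1 = 1 /\ (forall i, 1 <= i <= g -> 1 < seq_n s i),
      forall i, 1 <= i <= g ->
        in_semigroup (take i s) (seq_n s i * nth 0 s i)
    & forall i, 1 <= i <= g ->
        nth 0 s i < seq_n s i.-1 * nth 0 s i.-1].

(* The gluing of s1 and s2 through alpha and beta is a partial operation:
   [gluing] is the underlying total function on sequences, and
   [gluing_defined] the condition under which the gluing is defined. *)
Definition gluing (s1 s2 : seq nat) (alpha beta : nat) : seq nat :=
  [seq alpha * r | r <- s1] ++ [seq beta * r | r <- s2].

Definition gluing_defined (s1 s2 : seq nat) (alpha beta : nat) : Prop :=
  let g1 := (size s1).-1 in
  [/\ delta_sequence s1 /\ delta_sequence s2,
      in_semigroup s2 alpha,
      in_semigroup s1 beta,
      gcdn alpha beta = 1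
    & exists m, [/\ 1 < m,
                    alpha = m * nth 0 s2 0
                  & beta < m * seq_n s1 g1 * nth 0 s1 g1]].

(* (...((T U_{n_1,a_1} T) U_{n_2,a_2} T)...) U_{n_k,a_k} T *)
Fixpoint iterated_gluing (n a : nat -> nat) (k : nat) : seq nat :=
  if k is k'.+1 then gluing (iterated_gluing n a k') trivial_seq (n k) (a k)
  else trivial_seq.

(* [%/] truncates; the main statement also asserts that the division is exact. *)
Definition seq_a (s : seq nat) (i : nat) : nat :=
  nth 0 s i %/ \prod_(i.+1 <= j < size s) seq_n s j.

(* Main.v *)
(* Since d_(i+1) = gcd(d_i, delta_i) and d_(g+1) = 1, the product of the n_j for
   j > i telescopes to d_(i+1), so a_i = delta_i / d_(i+1) and n_i = d_i / d_(i+1)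
   are coprime integers.  By induction on k, the first k gluings produce
   (delta_0, ..., delta_k) / d_(k+1): the (k+1)-st one multiplies the previous
   terms by n_(k+1) and appends a_(k+1).  The conditions (a)-(c) and those of the
   gluing are homogeneous, hence all follow from those for Delta upon dividing by
   the appropriate d_i. *)

Require Import Defs.
From mathcomp Require Import all_boot.

Set Implicit Arguments.
Unset Strict Implicit.
Unset Printing Implicit Defensive.

Lemma seq_d1 s : seq_d s 1 = nth 0 s 0.
Proof. by rewrite /seq_d; case: s => [|r s] /=; rewrite ?take0 ?big_nil ?big_seq1. Qed.

Lemma seq_dS s i : seq_d s i.+1 = gcdn (seq_d s i) (nth 0 s i).
Proof.
rewrite /seq_d; have [lt_is | le_si] := ltnP i (size s).
  by rewrite (take_nth 0 lt_is) -cats1 big_cat big_seq1.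
(* Past the end both prefixes are all of [s], and the default entry 0 is neutral for [gcdn]. *)
by rewrite nth_default // gcdn0 !take_oversize // ltnW.
Qed.

Lemma dvdn_seq_dS s i : seq_d s i.+1 %| seq_d s i.
Proof. by rewrite seq_dS dvdn_gcdl. Qed.

Lemma dvdn_seq_d_nth s i : seq_d s i.+1 %| nth 0 s i.
Proof. by rewrite seq_dS dvdn_gcdr. Qed.

(** The index is a successor because [seq_d s 0] is the empty gcd, which is 0. *)
Lemma seq_d_gt0 s i : 0 < nth 0 s 0 -> 0 < seq_d s i.+1.
Proof.
move=> s0_gt0; elim: i => [|i IHi]; first by rewrite seq_d1.
by rewrite seq_dS gcdn_gt0 IHi.
Qed.

Lemma seq_d_take s k i : i <= k -> seq_d (take k s) i = seq_d s i.
Proof. by move=> le_ik; rewrite /seq_d take_takel. Qed.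

Lemma seq_d_scale c s i : seq_d [seq c * r | r <- s] i = c * seq_d s i.
Proof.
rewrite /seq_d -map_take big_map.
by rewrite (big_morph _ (muln_gcdr c) (muln0 c)).
Qed.

Lemma seq_n_take s k i : i < k -> seq_n (take k s) i = seq_n s i.
Proof. by move=> lt_ik; rewrite /seq_n !seq_d_take // ltnW. Qed.

Lemma seq_n_scale c s i : 0 < c -> seq_n [seq c * r | r <- s] i = seq_n s i.
Proof. by move=> c_gt0; rewrite /seq_n !seq_d_scale divnMl. Qed.

Lemma seq_nS_mul s i : seq_n s i.+1 * seq_d s i.+2 = seq_d s i.+1.
Proof. by rewrite /seq_n /= divnK // dvdn_seq_dS. Qed.

Lemma nth_scale c s i : nth 0 [seq c * r | r <- s] i = c * nth 0 s i.
Proof.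
have [lt_is | le_si] := ltnP i (size s); first exact: nth_map.
by rewrite !nth_default ?size_map ?muln0.
Qed.

(** The same coefficients serve on both sides once [c] is cancelled; this brings memberships known
    for [delta] down to the partial gluings. *)
Lemma in_semigroup_scale c s x : 0 < c ->
  in_semigroup [seq c * r | r <- s] (c * x) -> in_semigroup s x.
Proof.
move=> c_gt0 [f]; rewrite size_map => def_x; exists f.
apply/eqP; rewrite -(eqn_pmul2l c_gt0) def_x big_distrr /=; apply/eqP.
by apply: eq_bigr => j _; rewrite nth_scale mulnCA.
Qed.

Lemma prod_seq_n s i k : i <= k ->
  (\prod_(i.+1 <= j < k.+1) seq_n s j) * seq_d s k.+1 = seq_d s i.+1.
Proof.
elim: k => [|k IHk]; first by rewrite leqn0 => /eqP->; rewrite big_geq ?mul1n.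
rewrite leq_eqVlt => /predU1P[-> | lt_ik]; first by rewrite big_geq ?mul1n.
by rewrite big_nat_recr //= -mulnA seq_nS_mul IHk.
Qed.

Lemma in_semigroup_trivial_seq x : in_semigroup trivial_seq x.
Proof. by exists (fun=> x); rewrite big_ord_recl big_ord0 /= muln1 addn0. Qed.

Section Delta.

Variables (g : nat) (delta : seq nat).
Hypothesis size_delta : size delta = g.+1.
Hypothesis d_last : seq_d delta g.+1 = 1.

Local Notation n := (seq_n delta).
Local Notation a := (seq_a delta).
Local Notation d := (seq_d delta).

Lemma prod_seq_n_d i : i <= g -> \prod_(i.+1 <= j < g.+1) n j = d i.+1.
Proof. by move=> le_ig; rewrite -(prod_seq_n delta le_ig) d_last muln1. Qed.

Lemma d_mul_a i : i <= g -> d i.+1 * a i = nth 0 delta i.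
Proof.
move=> le_ig; rewrite /seq_a size_delta prod_seq_n_d // mulnC.
by rewrite divnK // dvdn_seq_d_nth.
Qed.

(** Multiplying the gluing by [d k.+1], rather than dividing [delta], avoids truncated division. The
    invariants of each stage are read off a prefix of [delta] through this identity. *)
Lemma iterated_gluing_scale k : k <= g ->
  take k.+1 delta = [seq d k.+1 * r | r <- iterated_gluing n a k].
Proof.
elim: k => [|k IHk] le_kg.
  rewrite seq_d1 /= muln1.
  by case: (delta) size_delta => //= r s _; rewrite take0.
rewrite (take_nth 0) ?size_delta // IHk ?(ltnW le_kg) //= /gluing map_cat /=.
rewrite muln1 d_mul_a // cats1; congr rcons.
(* On the old terms the new factor is absorbed by [n k.+1 * d k.+2 = d k.+1]. *)
rewrite -map_comp; apply: eq_map => r /=.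
by rewrite mulnA [_ * n _]mulnC seq_nS_mul.
Qed.

(** Multiplied by [d i.+2], the gcd becomes that of [d i.+1] and the entry of index [i.+1], which is
    [d i.+2] itself. *)
Lemma coprime_n_a i : 0 < nth 0 delta 0 -> i < g -> gcdn (n i.+1) (a i.+1) = 1.
Proof.
move=> delta0_gt0 lt_ig; have d_gt0 := seq_d_gt0 i.+1 delta0_gt0.
apply/eqP; rewrite -(eqn_pmul2l d_gt0) muln_gcdr.
by rewrite d_mul_a // mulnC seq_nS_mul -seq_dS muln1.
Qed.

Hypothesis delta_gt0 : forall r, r \in delta -> 0 < r.
Hypothesis n_gt1 : forall i, 1 <= i <= g -> 1 < n i.
Hypothesis n_delta_in : forall i, 1 <= i <= g ->
  in_semigroup (take i delta) (n i * nth 0 delta i).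
Hypothesis delta_lt : forall i, 1 <= i <= g ->
  nth 0 delta i < n i.-1 * nth 0 delta i.-1.

Let delta0_gt0 : 0 < nth 0 delta 0.
Proof. by apply/delta_gt0/mem_nth; rewrite size_delta. Qed.

Let d_gt0 i : 0 < d i.+1.
Proof. exact: seq_d_gt0. Qed.

Lemma size_iterated_gluing k : size (iterated_gluing n a k) = k.+1.
Proof. by elim: k => //= k IHk; rewrite /gluing size_cat !size_map IHk addn1. Qed.

Lemma nth_iterated_gluing k i : i <= k <= g ->
  d k.+1 * nth 0 (iterated_gluing n a k) i = nth 0 delta i.
Proof.
by case/andP=> le_ik le_kg; rewrite -nth_scale -iterated_gluing_scale // nth_take.
Qed.

Lemma seq_d_iterated_gluing k i : i <= k.+1 -> k <= g ->
  d k.+1 * seq_d (iterated_gluing n a k) i = d i.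
Proof.
move=> le_ik le_kg.
by rewrite -seq_d_scale -iterated_gluing_scale // seq_d_take.
Qed.

Lemma seq_n_iterated_gluing k i : i <= k <= g ->
  seq_n (iterated_gluing n a k) i = n i.
Proof.
case/andP=> le_ik le_kg.
by rewrite -(seq_n_scale _ _ (d_gt0 k)) -iterated_gluing_scale // seq_n_take.
Qed.

Lemma delta_sequence_iterated_gluing k : k <= g ->
  delta_sequence (iterated_gluing n a k).
Proof.
(* Stage 0 is the conventional sequence (1). Afterwards the stage is [k.+1], so the scaling factor
   is [d k.+2]. *)
case: k => [|k] lt_kg; first by left.
right; rewrite size_iterated_gluing [_.-1]/=.
set s := iterated_gluing n a k.+1.
split=> // [r s_r||i|i].
- rewrite -(ltn_pmul2l (d_gt0 k.+1)) muln0 delta_gt0 //.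
  apply: (@mem_take k.+2); rewrite iterated_gluing_scale //.
  exact: map_f.
- split=> [|i /andP[i_gt0 le_ik]].
    apply/eqP; rewrite -(eqn_pmul2l (d_gt0 k.+1)) muln1.
    by rewrite seq_d_iterated_gluing.
  by rewrite seq_n_iterated_gluing ?le_ik // n_gt1 // i_gt0 (leq_trans le_ik).
- case/andP=> i_gt0 le_ik; have le_ig := leq_trans le_ik lt_kg.
  apply: (in_semigroup_scale (d_gt0 k.+1)).
  rewrite map_take -iterated_gluing_scale // take_takel; last exact: leqW.
  rewrite mulnCA nth_iterated_gluing ?seq_n_iterated_gluing ?le_ik //.
  by apply: n_delta_in; rewrite i_gt0.
case/andP=> i_gt0 le_ik; have le_ig := leq_trans le_ik lt_kg.
(* The index [i.-1] may be 0; then both values of [seq_n] are n_0 = 1. *)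
have le_pik : i.-1 <= k.+1 <= g by rewrite lt_kg (leq_trans (leq_pred i)).
rewrite -(ltn_pmul2l (d_gt0 k.+1)) mulnCA.
rewrite !nth_iterated_gluing ?le_ik // seq_n_iterated_gluing //.
by rewrite delta_lt ?i_gt0.
Qed.

Lemma gluing_defined_iterated_gluing i : i < g ->
  gluing_defined (iterated_gluing n a i) trivial_seq (n i.+1) (a i.+1).
Proof.
move=> lt_ig; have le_ig := ltnW lt_ig.
(* Stage [i] is scaled by [d i.+1], whereas [a i.+1] has denominator [d i.+2]. The quotient [n i.+1]
   of the two is the multiplier in condition (b), which thus yields the membership of beta. *)
have d_a : d i.+1 * a i.+1 = n i.+1 * nth 0 delta i.+1.
  by rewrite -(seq_nS_mul delta i) -mulnA d_mul_a.
split.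
- by split; [exact: delta_sequence_iterated_gluing | left].
- exact: in_semigroup_trivial_seq.
- apply: (in_semigroup_scale (d_gt0 i)).
  by rewrite -iterated_gluing_scale // d_a; apply: n_delta_in.
- exact: coprime_n_a.
have n_i_gt1 : 1 < n i.+1 by rewrite n_gt1.
(* Since T starts with 1, m is alpha itself. *)
exists (n i.+1); split; rewrite ?muln1 //.
rewrite size_iterated_gluing /= seq_n_iterated_gluing ?leqnn //.
(* After scaling, both sides share the factor [n i.+1]; cancelling it leaves condition (c). *)
rewrite -(ltn_pmul2l (d_gt0 i)) d_a mulnCA nth_iterated_gluing ?leqnn //.
by rewrite -mulnA ltn_pmul2l ?(ltnW n_i_gt1) // (delta_lt (i := i.+1)).
Qed.

End Delta.

Theorem corollary3p6 (g : nat) (delta : seq nat) :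
  size delta = g.+1 ->
  delta_sequence delta ->
  [/\ forall i, 1 <= i <= g ->
        \prod_(i.+1 <= j < g.+1) seq_n delta j %| nth 0 delta i,
      forall i, 1 <= i <= g ->
        gluing_defined (iterated_gluing (seq_n delta) (seq_a delta) i.-1)
          trivial_seq (seq_n delta i) (seq_a delta i)
    & delta = iterated_gluing (seq_n delta) (seq_a delta) g].
Proof.
move=> size_delta [def_delta | /=].
  have g0 : g = 0 by move: size_delta; rewrite def_delta => -[].
  by rewrite g0; split=> // i; rewrite leqn0 lt0n => /andP[/negPf->].
rewrite size_delta /= => -[_ delta_gt0 [d_last n_gt1] n_delta_in delta_lt].
split=> [i /andP[_ le_ig] | [//|i] lt_ig |].
- by rewrite prod_seq_n_d // dvdn_seq_d_nth.
- by apply: gluing_defined_iterated_gluing lt_ig.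
(* At stage [g] the prefix is all of [delta] and the scaling factor is 1. *)
rewrite -[LHS](take_oversize (n := g.+1)) ?size_delta //.
rewrite (iterated_gluing_scale size_delta) // d_last.
by rewrite (eq_map mul1n) map_id.
Qed.
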